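(* For any $u\in C_c(\mathbb{N})$ with $u_0=u_1=0$, $$\sum_{n \geq 1} |\Delta u_n|^2 \geq \sum_{n\geq 2} \rho_n\, u^2_n,$$ where, for $n\geq 2$, $$\rho_n=\frac{1}{4n^2}\left[1 + \Big(1 - \frac{1}{n}\Big)^{-2} - \Big(1 - \frac{1}{n}\Big)^{-\frac{1}{2}} - \Big(1 + \frac{1}{n}\Big)^{\frac{3}{2}}\right]+\sum_{k=2}^\infty\frac{(2k+1)^2\binom{4k}{2k}}{(4k-1)\,2^{4k+1}}\,\frac{1}{n^{2k+2}},$$ whose expansion in powers of $1/n$ begins $$\rho_n=\frac{9}{16n^4} + \frac{15}{16 n^5}+ \frac{213}{128 n^6}+ \cdots .$$
   Context: $\mathbb{N}=\{0,1,2,\dots\}$, $C_c(\mathbb{N})$ is the space of finitely supported real sequences $u=(u_n)_{n\in\mathbb{N}}$, and $\Delta u_n = 2u_n-u_{n+1}-u_{n-1}$ for $n\geq 1$. *)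

(* Defs.v *)
From Stdlib Require Import Reals ZArith Lra Lia.
From Coquelicot Require Import Coquelicot.
Open Scope R_scope.

Definition sum_from (m : nat) (f : nat -> R) : R :=
  Series (fun j : nat => f (m + j)%nat).

Definition finitely_supported (u : nat -> R) : Prop :=
  exists N : nat, forall n : nat, (N <= n)%nat -> u n = 0.

(* Only meaningful for [n >= 1]: the subtraction on [nat] is truncated. *)
Definition laplacian (u : nat -> R) (n : nat) : R :=
  2 * u n - u (n + 1)%nat - u (n - 1)%nat.

(* [Binomial.C] is qualified because Coquelicot reuses [C] for the complex
   numbers. *)
Definition rho_term (n k : nat) : R :=
  (2 * INR k + 1) ^ 2 * Binomial.C (4 * k) (2 * k)
  / ((4 * INR k - 1) * 2 ^ (4 * k + 1))
  * (1 / INR n ^ (2 * k + 2)).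

Definition rho (n : nat) : R :=
  1 / (4 * INR n ^ 2)
  * (1 + Rpower (1 - 1 / INR n) (-2)
       - Rpower (1 - 1 / INR n) (- (1 / 2))
       - Rpower (1 + 1 / INR n) (3 / 2))
  + sum_from 2 (rho_term n).

Lemma sum_f_R0_ge_term (f : nat -> R) (n i : nat) :
  (forall j, 0 <= f j) -> (i <= n)%nat -> f i <= sum_f_R0 f n.
Proof.
intros Hf; induction n as [|n IH]; intros Hi.
- replace i with 0%nat by lia; simpl; lra.
- simpl; destruct (Nat.eq_dec i (S n)) as [->|Hne].
  + pose proof (cond_pos_sum f n Hf); lra.
  + specialize (IH ltac:(lia)); pose proof (Hf (S n)); lra.
Qed.

Lemma binomial_nonneg (n i : nat) : 0 <= Binomial.C n i.
Proof.
unfold Binomial.C, Rdiv; apply Rmult_le_pos; [apply pos_INR|].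
apply Rlt_le, Rinv_0_lt_compat, Rmult_lt_0_compat; apply INR_fact_lt_0.
Qed.

Lemma binomial_le_pow2 (n i : nat) : (i <= n)%nat -> Binomial.C n i <= 2 ^ n.
Proof.
intros Hi.
assert (E := binomial 1 1 n); replace (1 + 1) with 2 in E by ring.
rewrite E.
assert (B := sum_f_R0_ge_term
  (fun j => Binomial.C n j * 1 ^ j * 1 ^ (n - j)) n i).
cbv beta in B; rewrite !pow1, !Rmult_1_r in B.
apply B; [|exact Hi].
intros j; rewrite !pow1, !Rmult_1_r; apply binomial_nonneg.
Qed.

(* [Series] is a total operator, so the convergence of the series in [rho]
   has to be established separately. *)
Lemma ex_series_rho (n : nat) :
  (2 <= n)%nat -> ex_series (fun j : nat => rho_term n (2 + j)).
Proof.
intros Hn.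
apply (@ex_series_le R_AbsRing R_CompleteNormedModule _
         (fun j => (1 / 2) ^ j)).
2: { apply ex_series_geom; rewrite Rabs_pos_eq; lra. }
intros j; change (Rabs (rho_term n (2 + j)) <= (1 / 2) ^ j).
set (k := (2 + j)%nat).
assert (Hk : 2 <= INR k) by (apply (le_INR 2); unfold k; lia).
assert (Hn2 : 2 <= INR n) by (apply (le_INR 2); lia).
pose proof (binomial_nonneg (4 * k) (2 * k)) as HC0.
pose proof (binomial_le_pow2 (4 * k) (2 * k) ltac:(lia)) as HC.
assert (HP : 0 < 2 ^ (4 * k)) by (apply pow_lt; lra).
assert (HQ : 0 < INR n ^ (2 * k + 2)) by (apply pow_lt; lra).
assert (HQ2 : 2 ^ (2 * k + 2) <= INR n ^ (2 * k + 2))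
  by (apply pow_incr; lra).
assert (Hk2 : INR k <= 2 ^ k).
{ clear; induction k as [|k IH]; [simpl; lra|].
  rewrite S_INR; simpl.
  assert (1 <= 2 ^ k) by (apply pow_R1_Rle; lra); lra. }
assert (H2k : 0 < 2 ^ k) by (apply pow_lt; lra).
assert (A : 0 <= (2 * INR k + 1) ^ 2 * Binomial.C (4 * k) (2 * k)
  / ((4 * INR k - 1) * 2 ^ (4 * k + 1)) <= 2 * 2 ^ k).
{ rewrite pow_add, pow_1; split.
  - apply Rmult_le_pos; [nra|apply Rlt_le, Rinv_0_lt_compat; nra].
  - apply Rle_div_l; [nra|].
    apply Rle_trans with ((2 * INR k + 1) ^ 2 * 2 ^ (4 * k)).
    { apply Rmult_le_compat_l; [nra|exact HC]. }
    replace (2 * 2 ^ k * ((4 * INR k - 1) * (2 ^ (4 * k) * 2)))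
      with ((4 * 2 ^ k * (4 * INR k - 1)) * 2 ^ (4 * k)) by ring.
    apply Rmult_le_compat_r; [lra|].
    apply Rle_trans with (4 * INR k * (4 * INR k - 1)); [nra|].
    apply Rmult_le_compat_r; lra. }
assert (B : 0 <= 1 / INR n ^ (2 * k + 2) <= 1 / 2 ^ (2 * k + 2)).
{ split; unfold Rdiv; rewrite !Rmult_1_l.
  - apply Rlt_le, Rinv_0_lt_compat; exact HQ.
  - apply Rinv_le_contravar; [apply pow_lt; lra|exact HQ2]. }
unfold rho_term; rewrite Rabs_pos_eq by (apply Rmult_le_pos; lra).
apply Rle_trans with (2 * 2 ^ k * (1 / 2 ^ (2 * k + 2))).
{ apply Rmult_le_compat; lra. }
assert (H2j : 0 < 2 ^ j) by (apply pow_lt; lra).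
replace ((1 / 2) ^ j) with (/ 2 ^ j)
  by (unfold Rdiv; rewrite Rmult_1_l, pow_inv; reflexivity).
replace (2 * k + 2)%nat with (j + j + 6)%nat by (unfold k; lia).
unfold k; rewrite !pow_add.
replace (2 * (2 ^ 2 * 2 ^ j) * (1 / (2 ^ j * 2 ^ j * 2 ^ 6)))
  with (1 / 8 * / 2 ^ j) by (field; lra).
assert (0 < / 2 ^ j) by (apply Rinv_0_lt_compat; lra); lra.
Qed.

(* Main.v *)
Require Import Defs.
From Stdlib Require Import Reals Lra Lia.
From Coquelicot Require Import Coquelicot.
Open Scope R_scope.

(** With [v n = u (n + 1) - u n] the left-hand side is the sum of
    [(v n - v (n - 1)) ^ 2], so Hardy's inequality with the ground state
    [sqrt n] bounds it below by the sum of
    [(2 - sqrt (1 + 1 / n) - sqrt (1 - 1 / n)) * v n ^ 2].  The weight expands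
    as a series in [1 / n ^ (2 * k)] with positive coefficients, and to each
    term one applies the Hardy inequality for the edge weight
    [1 / n ^ (2 * k)] with the ground state [n ^ (k + 1/2)].  For [k = 1] the
    resulting potential is kept exactly; for [k >= 2] it is bounded below by
    its leading part [(k + 1/2) ^ 2 / n ^ (2 * k + 2)].  The expansion of [rho]
    comes from the binomial series. *)

(** * The binomial series of [(1 + x) ^ al] *)

(** Generalized binomial coefficient [al (al - 1) ... (al - n + 1) / n!] for real [al]. *)
Fixpoint gbinom (al : R) (n : nat) : R :=
  match n with
  | O => 1
  | S m => gbinom al m * (al - INR m) / (INR m + 1)
  end.

Lemma gbinom_neq_0 (al : R) (n : nat) :
  (forall m : nat, al <> INR m) -> gbinom al n <> 0.
Proof.
intros Hal; induction n as [|n IH]; simpl; [lra|].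
pose proof (pos_INR n); pose proof (Hal n).
unfold Rdiv; repeat apply Rmult_integral_contrapositive_currified; try lra.
apply Rinv_neq_0_compat; lra.
Qed.

(** Ratio test: no coefficient vanishes, and the quotient of consecutive ones is
    [(al + 1) / (n + 1) - 1], which tends to [-1]. *)
Lemma CV_radius_gbinom (al : R) :
  (forall m : nat, al <> INR m) -> CV_radius (gbinom al) = 1.
Proof.
intros Hal.
rewrite <- Rinv_1 at 1.
apply CV_radius_finite_DAlembert; [|lra|].
{ intros n; now apply gbinom_neq_0. }
apply is_lim_seq_ext with
  (fun n : nat => Rabs ((al + 1) * / INR (S n) - 1)).
{ intros n; f_equal; rewrite S_INR; simpl gbinom.
  pose proof (pos_INR n); pose proof (gbinom_neq_0 al n Hal).
  field; split; lra. }
replace (Finite 1) with (Rbar_abs (Finite (-1)))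
  by (simpl; f_equal; unfold Rabs; destruct Rcase_abs; lra).
apply is_lim_seq_abs.
replace (Finite (-1)) with (Finite ((al + 1) * 0 - 1)) by (f_equal; ring).
apply is_lim_seq_minus'; [|apply is_lim_seq_const].
apply is_lim_seq_mult'; [apply is_lim_seq_const|].
apply (is_lim_seq_incr_1 (fun n => / INR n)).
change (Finite 0) with (Rbar_inv p_infty).
apply is_lim_seq_inv; [apply is_lim_seq_INR|discriminate].
Qed.

(** Coefficientwise this is the recursion [(n + 1) * c (n + 1) + n * c n = al * c n]. *)
Lemma gbinom_ode (al x : R) :
  (forall m : nat, al <> INR m) -> Rabs x < 1 ->
  (1 + x) * PSeries (PS_derive (gbinom al)) x = al * PSeries (gbinom al) x.
Proof.
intros Hal Hx.
assert (Hex : ex_pseries (PS_derive (gbinom al)) x).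
{ apply CV_radius_inside; rewrite CV_radius_derive, CV_radius_gbinom by exact Hal.
  exact Hx. }
rewrite Rmult_plus_distr_r, Rmult_1_l.
rewrite <- PSeries_incr_1, <- PSeries_plus, <- PSeries_scal.
2: exact Hex.
2: now apply ex_pseries_incr_1.
apply PSeries_ext; intros [|n].
- unfold PS_plus, PS_scal, PS_incr_1, PS_derive; simpl.
  unfold plus, scal, zero; simpl; unfold mult; simpl; field.
- unfold PS_plus, PS_scal, PS_incr_1, PS_derive.
  change (INR (S (S n)) * gbinom al (S (S n)) + INR (S n) * gbinom al (S n)
            = al * gbinom al (S n)).
  cbn [gbinom]; rewrite !S_INR.
  pose proof (pos_INR n); field; split; lra.
Qed.

(** By [gbinom_ode] the product of the series with [(1 + x) ^ (- al)] has derivative zero on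
    [(-1, 1)], so it keeps its value 1 at 0. *)
Lemma is_pseries_gbinom (al x : R) :
  (forall m : nat, al <> INR m) -> Rabs x < 1 ->
  is_pseries (gbinom al) x (Rpower (1 + x) al).
Proof.
intros Hal Hx.
assert (Hcv : forall y, Rabs y < 1 -> Rbar_lt (Rabs y) (CV_radius (gbinom al)))
  by (intros y Hy; rewrite CV_radius_gbinom by exact Hal; exact Hy).
set (g := fun y => PSeries (gbinom al) y * Rpower (1 + y) (- al)).
assert (Hg : forall y, Rabs y < 1 -> is_derive g y 0).
{ intros y Hy.
  assert (0 < 1 + y) by (apply Rabs_lt_between in Hy; lra).
  assert (D : is_derive (fun t => Rpower (1 + t) (- al)) y
                (- al / (1 + y) * Rpower (1 + y) (- al))).
  { unfold Rpower; auto_derive; [lra|]; field; lra. }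
  pose proof (is_derive_PSeries (gbinom al) y (Hcv y Hy)) as D'.
  pose proof (is_derive_mult _ _ _ _ _ D' D Rmult_comm) as D2.
  replace 0 with
    (plus (mult (PSeries (PS_derive (gbinom al)) y) (Rpower (1 + y) (- al)))
       (mult (PSeries (gbinom al) y) (- al / (1 + y) * Rpower (1 + y) (- al))));
    [exact D2|].
  unfold plus, mult; simpl.
  pose proof (gbinom_ode al y Hal Hy) as E.
  replace (PSeries (PS_derive (gbinom al)) y)
    with (al * PSeries (gbinom al) y / (1 + y)) by (rewrite <- E; field; lra).
  field; lra. }
assert (Hg0 : g x = g 0).
{ apply Rabs_lt_between in Hx.
  assert (Hb : forall y, -1 < y < 1 -> is_derive g y 0)
    by (intros y Hy; apply Hg, Rabs_lt_between; lra).
  destruct (Rtotal_order x 0) as [H|[->|H]]; [|reflexivity|symmetry];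
    apply (eq_is_derive g); try lra; intros; apply Hb; lra. }
assert (E : PSeries (gbinom al) x = Rpower (1 + x) al).
{ unfold g in Hg0; rewrite PSeries_0, Rplus_0_r in Hg0.
  replace (Rpower 1 (- al)) with 1 in Hg0
    by (unfold Rpower; rewrite ln_1, Rmult_0_r, exp_0; reflexivity).
  simpl in Hg0; rewrite Rpower_Ropp in Hg0.
  assert (0 < Rpower (1 + x) al) by apply exp_pos.
  apply Rmult_eq_reg_r with (/ Rpower (1 + x) al).
  - rewrite Hg0; field; lra.
  - apply Rinv_neq_0_compat; lra. }
rewrite <- E; apply PSeries_correct, CV_radius_inside, Hcv, Hx.
Qed.

(** * Power series of the Hardy weight *)

(** Minus the coefficient of [x ^ (2 * k)] in [sqrt (1 + x)]; thus [2 - sqrt (1 + x) - sqrt (1 - x)]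
    has the coefficients [2 * hardy_coef k] for [k >= 1]. *)
Definition hardy_coef (k : nat) : R :=
  Binomial.C (4 * k) (2 * k) / ((4 * INR k - 1) * 2 ^ (4 * k)).

Lemma half_neq_INR (m : nat) : 1 / 2 <> INR m.
Proof.
intros H; destruct m as [|m]; [simpl in H; lra|].
rewrite S_INR in H; pose proof (pos_INR m); lra.
Qed.

Lemma central_binomial_S (m : nat) :
  Binomial.C (2 * S m) (S m)
  = Binomial.C (2 * m) m * (2 * (2 * INR m + 1) / (INR m + 1)).
Proof.
unfold Binomial.C.
replace (2 * S m - S m)%nat with (S m) by lia.
replace (2 * m - m)%nat with m by lia.
replace (2 * S m)%nat with (S (S (2 * m))) by lia.
rewrite !fact_simpl, !mult_INR, !S_INR, !mult_INR.
replace (INR 2) with 2 by (simpl; ring).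
pose proof (pos_INR m); pose proof (INR_fact_neq_0 m).
field; split; lra.
Qed.

(** Passing from [m] to [m + 1] multiplies both sides by [(1 / 2 - m) / (m + 1)]. *)
Lemma gbinom_half (m : nat) :
  gbinom (1 / 2) m
  = - (-1) ^ m * (Binomial.C (2 * m) m / ((2 * INR m - 1) * 4 ^ m)).
Proof.
induction m as [|m IH].
- unfold Binomial.C; simpl; field.
- rewrite central_binomial_S; cbn [gbinom]; rewrite IH, S_INR; cbn [pow].
  pose proof (pos_INR m); pose proof (half_neq_INR m).
  assert (4 ^ m <> 0) by (apply pow_nonzero; lra).
  field; repeat split; lra.
Qed.

Lemma gbinom_half_even (k : nat) : gbinom (1 / 2) (2 * k) = - hardy_coef k.
Proof.
rewrite gbinom_half, pow_1_even; unfold hardy_coef.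
replace (2 * (2 * k))%nat with (4 * k)%nat by lia.
rewrite mult_INR; replace (INR 2) with 2 by (simpl; ring).
replace (4 ^ (2 * k)) with (2 ^ (4 * k)).
- replace (2 * (2 * INR k)) with (4 * INR k) by ring; ring.
- replace (4 * k)%nat with (2 * (2 * k))%nat by lia.
  rewrite pow_mult; f_equal; ring.
Qed.

(** The index starts at 1 because [hardy_coef 0 = -1]. *)
Lemma hardy_coef_ge_0 (k : nat) : 0 <= hardy_coef (S k).
Proof.
unfold hardy_coef; rewrite S_INR; pose proof (pos_INR k).
apply Rmult_le_pos; [apply binomial_nonneg|].
apply Rlt_le, Rinv_0_lt_compat, Rmult_lt_0_compat; [lra|apply pow_lt; lra].
Qed.

(** Adding the binomial series at [x] and [- x] cancels the odd powers. After the constant 2 is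
    removed and the sign changed, all terms are nonnegative, so partial sums stay below the full
    sum. *)
Lemma hardy_sum_lt_1 (x : R) (K : nat) :
  0 < x < 1 ->
  sum_f_R0 (fun i => 2 * hardy_coef (S i) * x ^ (2 * S i)) K
    <= 2 - sqrt (1 + x) - sqrt (1 - x).
Proof.
intros Hx.
set (h := fun j : nat => gbinom (1 / 2) j * x ^ j + gbinom (1 / 2) j * (- x) ^ j).
assert (Hh : is_series h (sqrt (1 + x) + sqrt (1 - x))).
{ rewrite <- !Rpower_sqrt by lra.
  replace (/ 2) with (1 / 2) by lra.
  apply (is_series_plus (V := R_NormedModule) _ _ _ _).
  - apply is_pseries_R, is_pseries_gbinom; [exact half_neq_INR|].
    apply Rabs_lt_between; lra.
  - apply is_pseries_R.
    replace (1 - x) with (1 + - x) by ring.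
    apply is_pseries_gbinom; [exact half_neq_INR|].
    apply Rabs_lt_between; lra. }
assert (Hodd : forall i, - h (S (2 * i)) = 0).
{ intros i; unfold h.
  replace (- x) with (-1 * x) by ring.
  rewrite Rpow_mult_distr, pow_1_odd; ring. }
assert (Heven : forall i, - h (2 * S i)%nat
                          = 2 * hardy_coef (S i) * x ^ (2 * S i)).
{ intros i; unfold h; rewrite gbinom_half_even.
  replace (- x) with (-1 * x) by ring.
  rewrite Rpow_mult_distr, pow_1_even; ring. }
assert (Hs : is_series (fun j => - h (S j)) (2 - sqrt (1 + x) - sqrt (1 - x))).
{ assert (H1 : is_series (fun j => h (S j)) (sqrt (1 + x) + sqrt (1 - x) - 2)).
  { apply (is_series_incr_1 h).
    replace (plus _ _) with (sqrt (1 + x) + sqrt (1 - x)); [exact Hh|].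
    unfold plus, h; simpl; ring. }
  replace (2 - _ - _) with (opp (sqrt (1 + x) + sqrt (1 - x) - 2))
    by (unfold opp; simpl; ring).
  exact (is_series_opp _ _ H1). }
apply is_series_Reals in Hs.
(* The indices 1 to [2 * K + 2] of [h] include exactly [K + 1] even ones; the odd ones contribute
   zero. *)
apply Rle_trans with (sum_f_R0 (fun j => - h (S j)) (S (2 * K))).
- apply Req_le; induction K as [|K IH].
  + specialize (Hodd 0%nat); specialize (Heven 0%nat).
    clearbody h; simpl in *; lra.
  + replace (S (2 * S K)) with (S (S (S (2 * K)))) by lia.
    rewrite (tech5 _ K), IH, <- (Heven (S K)).
    rewrite (tech5 _ (S (S (2 * K)))), (tech5 _ (S (2 * K))).
    replace (S (S (2 * K))) with (2 * S K)%nat by lia.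
    rewrite Hodd; replace (S (S (2 * S K))) with (2 * S (S K))%nat by lia.
    ring.
- apply (sum_incr _ _ _ Hs).
  intros j; destruct (Nat.Even_or_Odd j) as [[i ->]|[i ->]].
  + rewrite Hodd; lra.
  + replace (S (2 * i + 1)) with (2 * S i)%nat by lia.
    rewrite Heven; pose proof (hardy_coef_ge_0 i).
    assert (0 < x ^ (2 * S i)) by (apply pow_lt; lra); nra.
Qed.

(* At [x = 1] the binomial series sits on its circle of convergence: pass to
   the limit in the partial sums. *)
Lemma hardy_sum (x : R) (K : nat) :
  0 < x <= 1 ->
  sum_f_R0 (fun i => 2 * hardy_coef (S i) * x ^ (2 * S i)) K
    <= 2 - sqrt (1 + x) - sqrt (1 - x).
Proof.
intros [H0 [H1| ->]]; [now apply hardy_sum_lt_1|].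
(* The shift by two keeps [y 0] positive. *)
set (y := fun n : nat => 1 - / INR (S (S n))).
assert (Hy : forall n, 0 < y n < 1).
{ intros n; unfold y; rewrite !S_INR; pose proof (pos_INR n).
  assert (0 < / (INR n + 1 + 1)) by (apply Rinv_0_lt_compat; lra).
  assert (/ (INR n + 1 + 1) < / 1) by (apply Rinv_lt_contravar; lra).
  lra. }
assert (Ly : is_lim_seq y 1).
{ replace (Finite 1) with (Finite (1 - 0)) by (f_equal; ring).
  apply is_lim_seq_minus'; [apply is_lim_seq_const|].
  apply (is_lim_seq_incr_1 (fun n => / INR (S n))).
  apply (is_lim_seq_incr_1 (fun n => / INR n)).
  change (Finite 0) with (Rbar_inv p_infty).
  apply is_lim_seq_inv; [apply is_lim_seq_INR|discriminate]. }
apply (is_lim_seq_le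
  (fun n => sum_f_R0 (fun i => 2 * hardy_coef (S i) * y n ^ (2 * S i)) K)
  (fun n => 2 - sqrt (1 + y n) - sqrt (1 - y n))
  (sum_f_R0 (fun i => 2 * hardy_coef (S i) * 1 ^ (2 * S i)) K)
  (2 - sqrt (1 + 1) - sqrt (1 - 1))).
- intros n; now apply hardy_sum_lt_1.
- assert (Lp : forall m, is_lim_seq (fun n => y n ^ m) (1 ^ m)).
  { intros m; apply (is_lim_seq_continuous (fun t => t ^ m) y 1); trivial.
    apply derivable_continuous_pt, derivable_pt_pow. }
  induction K as [|K IH]; cbn [sum_f_R0];
    [|apply is_lim_seq_plus'; [exact IH|]];
    (apply is_lim_seq_mult'; [apply is_lim_seq_const|apply Lp]).
- apply is_lim_seq_minus'; [apply is_lim_seq_minus'; [apply is_lim_seq_const|]|].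
  + apply (is_lim_seq_continuous sqrt (fun n => 1 + y n)).
    * apply continuity_pt_sqrt; lra.
    * apply is_lim_seq_plus'; [apply is_lim_seq_const|exact Ly].
  + apply (is_lim_seq_continuous sqrt (fun n => 1 - y n)).
    * apply continuity_pt_sqrt; lra.
    * apply is_lim_seq_minus'; [apply is_lim_seq_const|exact Ly].
Qed.

(** * Hardy inequalities from ground states *)

(* [phi] is the ground state for the potential on the left; on each edge
   [(s - t)^2 >= (1 - p / q) s^2 + (1 - q / p) t^2] by AM-GM; the subtracted
   boundary term vanishes once [u (S N) = 0]. *)
Lemma discrete_hardy (c phi u : nat -> R) (N : nat) :
  (forall n, 0 <= c n) -> 0 <= phi 0%nat -> (forall n, 0 < phi (S n)) ->
  u 0%nat = 0 ->
  sum_f_R0 (fun n => (c n * (1 - phi n / phi (S n))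
                      + c (S n) * (1 - phi (S (S n)) / phi (S n)))
                     * u (S n) ^ 2) N
    - c (S N) * (1 - phi (S (S N)) / phi (S N)) * u (S N) ^ 2
  <= sum_f_R0 (fun n => c n * (u (S n) - u n) ^ 2) N.
Proof.
intros Hc H0 Hphi Hu; induction N as [|N IH].
(* Since [u 0 = 0], the first edge gives [c 0 * u 1 ^ 2], and only the nonnegative
   [c 0 * (phi 0 / phi 1) * u 1 ^ 2] is lost. *)
- simpl sum_f_R0; rewrite Hu.
  assert (0 <= phi 0%nat / phi 1%nat) by (apply Rdiv_le_0_compat; auto).
  assert (0 <= c 0%nat * (phi 0%nat / phi 1%nat) * u 1%nat ^ 2).
  { apply Rmult_le_pos; [apply Rmult_le_pos; auto|apply pow2_ge_0]. }
  nra.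
- rewrite !tech5.
  set (p := phi (S N)) in *; set (q := phi (S (S N))) in *.
  set (t := u (S N)) in *; set (s := u (S (S N))) in *.
  assert (Hp : 0 < p) by apply Hphi; assert (Hq : 0 < q) by apply Hphi.
  assert (E : (1 - p / q) * s ^ 2 + (1 - q / p) * t ^ 2 <= (s - t) ^ 2).
  { apply Rminus_le_0.
    replace ((s - t) ^ 2 - _) with ((p * s - q * t) ^ 2 / (p * q))
      by (field; lra).
    apply Rdiv_le_0_compat; [apply pow2_ge_0|nra]. }
  apply (Rmult_le_compat_l (c (S N))) in E; [|apply Hc].
  revert IH E; generalize (p / q) (q / p) (phi (S (S (S N))) / q); intros; lra.
Qed.

(** Two uses of [1 + t <= exp t]: at [t = - y] it gives [ln (1 - y) <= - y], and at
    [t = - a * ln (1 - y)] the claim. *)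
Lemma Rpower_opp_ge (a y : R) :
  0 <= a -> 0 <= y < 1 -> 1 + a * y <= Rpower (1 - y) (- a).
Proof.
intros Ha Hy; unfold Rpower.
assert (L : ln (1 - y) <= - y).
{ rewrite <- (ln_exp (- y)); apply ln_le; [lra|].
  pose proof (exp_ineq1_le (- y)); lra. }
pose proof (exp_ineq1_le (- a * ln (1 - y))); nra.
Qed.

(* With [P = (1 - x)^(- (k - 1/2))], [Q = (1 - x)^(- (k + 1/2))] and
   [s = (1 + x)^(k + 1/2)] the right-hand side is [(P - 1) (Q - 1) + (Q - s)],
   and Bernoulli's inequality bounds the two summands by [(k^2 - 1/4) x^2] and
   [(k + 1/2) x^2]. *)
Lemma rellich_weight_ge (k : nat) (x : R) :
  (1 <= k)%nat -> 0 < x < 1 ->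
  (INR k + 1 / 2) ^ 2 * x ^ 2
  <= / (1 - x) ^ (2 * k) * (1 - Rpower (1 - x) (INR k + 1 / 2))
     + (1 - Rpower (1 + x) (INR k + 1 / 2)).
Proof.
intros Hk Hx; assert (Hk1 : 1 <= INR k) by (apply (le_INR 1); exact Hk).
set (b := INR k + 1 / 2); set (a := INR k - 1 / 2).
set (P := Rpower (1 - x) (- a)); set (Q := Rpower (1 - x) (- b)).
set (s := Rpower (1 + x) b).
assert (E1 : / (1 - x) ^ (2 * k) = P * Q).
{ unfold P, Q; rewrite <- Rpower_plus, <- Rpower_pow by lra.
  rewrite <- Rpower_Ropp; f_equal; rewrite mult_INR; unfold a, b; simpl; field. }
assert (E2 : P * Q * Rpower (1 - x) b = P).
{ unfold P, Q; rewrite <- !Rpower_plus; f_equal; ring. }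
assert (HP : 1 + a * x <= P) by (apply Rpower_opp_ge; unfold a; lra).
assert (HQ : 1 + b * x <= Q) by (apply Rpower_opp_ge; unfold b; lra).
assert (Hs : 1 <= s).
{ unfold s; rewrite <- (Rpower_O (1 + x)) at 1 by lra.
  apply Rle_Rpower; unfold b; lra. }
assert (HQs : 1 + b * x ^ 2 <= Q / s).
{ replace (Q / s) with (Rpower (1 - x ^ 2) (- b)).
  - apply Rpower_opp_ge; [unfold b; lra|nra].
  - replace (1 - x ^ 2) with ((1 - x) * (1 + x)) by ring.
    rewrite <- Rpower_mult_distr by lra.
    unfold Q, s, Rdiv; rewrite (Rpower_Ropp (1 + x)); reflexivity. }
assert (HQs' : (1 + b * x ^ 2) * s <= Q).
{ apply (Rmult_le_compat_r s) in HQs; [|lra].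
  replace (Q / s * s) with Q in HQs by (field; lra); exact HQs. }
assert (Hprod : a * x * (b * x) <= (P - 1) * (Q - 1)).
{ apply Rmult_le_compat; try lra; apply Rmult_le_pos; unfold a, b; lra. }
assert (0 <= b * x ^ 2) by (apply Rmult_le_pos; [unfold b; lra|nra]).
assert (b * x ^ 2 <= Q - s) by nra.
rewrite E1, Rmult_minus_distr_l, E2.
(* Since [a + 1 = b], the two bounds add up to exactly [b ^ 2 * x ^ 2]. *)
replace (b ^ 2 * x ^ 2) with (a * x * (b * x) + b * x ^ 2)
  by (unfold a, b; field).
lra.
Qed.

Lemma Rpower_div (x y z : R) :
  0 < x -> 0 < y -> Rpower x z / Rpower y z = Rpower (x / y) z.
Proof.
intros Hx Hy; unfold Rdiv.
rewrite <- Rpower_mult_distr by (try apply Rinv_0_lt_compat; lra).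
f_equal; unfold Rpower; rewrite ln_Rinv by lra.
rewrite <- exp_Ropp; f_equal; ring.
Qed.

(** Potential at [n] of the ground state [n ^ (k + 1/2)] when the edge from [m] to [m + 1] has
    weight [1 / m ^ (2 * k)]. The factor [1 / n ^ (2 * k)] is taken out to leave a function of
    [1 / n]. *)
Definition rellich_weight (k n : nat) : R :=
  (1 / INR n) ^ (2 * k)
  * (/ (1 - 1 / INR n) ^ (2 * k) * (1 - Rpower (1 - 1 / INR n) (INR k + 1 / 2))
     + (1 - Rpower (1 + 1 / INR n) (INR k + 1 / 2))).

(** An instance of [discrete_hardy] shifted by one: [u 1] becomes the left boundary value, and the
    edge weights start at [1 / 1]. *)
Lemma weighted_hardy (u : nat -> R) (k N : nat) :
  u 1%nat = 0 -> u (S (S N)) = 0 ->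
  sum_f_R0 (fun j => rellich_weight k (2 + j) * u (2 + j)%nat ^ 2) N
  <= sum_f_R0 (fun j => (1 / INR (S j)) ^ (2 * k)
                        * (u (S (S j)) - u (S j)) ^ 2) N.
Proof.
intros H1 HN.
pose proof (discrete_hardy (fun j => (1 / INR (S j)) ^ (2 * k))
  (fun j => Rpower (INR (S j)) (INR k + 1 / 2)) (fun j => u (S j)) N) as H.
cbv beta in H; rewrite HN in H.
replace (0 ^ 2) with 0 in H by ring; rewrite Rmult_0_r, Rminus_0_r in H.
assert (Hpos : forall j, 0 < INR (S j)) by (intros; apply lt_0_INR; lia).
eapply Rle_trans; [|apply H; trivial].
- apply Req_le, sum_eq; intros j _; change (2 + j)%nat with (S (S j)).
  f_equal; rewrite !Rpower_div by apply Hpos.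
  unfold rellich_weight.
  replace (1 - 1 / INR (S (S j))) with (INR (S j) / INR (S (S j)))
    by (rewrite !S_INR; pose proof (pos_INR j); field; lra).
  replace (1 + 1 / INR (S (S j))) with (INR (S (S (S j))) / INR (S (S j)))
    by (rewrite !S_INR; pose proof (pos_INR j); field; lra).
  rewrite Rmult_plus_distr_l; f_equal; rewrite <- Rmult_assoc; f_equal.
  rewrite <- pow_inv, <- Rpow_mult_distr; f_equal.
  pose proof (Hpos j); pose proof (Hpos (S j)); field; lra.
- intros; apply pow_le, Rlt_le, Rdiv_lt_0_compat; [lra|apply Hpos].
- apply Rlt_le, exp_pos.
- intros; apply exp_pos.
Qed.

(** Unit edge weights and ground state [sqrt n], whose value at 0 is zero. *)
Lemma hardy_sqrt (v : nat -> R) (N : nat) :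
  v 0%nat = 0 -> v (S N) = 0 ->
  sum_f_R0 (fun j => (2 - sqrt (1 + 1 / INR (S j)) - sqrt (1 - 1 / INR (S j)))
                     * v (S j) ^ 2) N
  <= sum_f_R0 (fun j => (v (S j) - v j) ^ 2) N.
Proof.
intros H0 HN.
pose proof (discrete_hardy (fun _ => 1) (fun j => sqrt (INR j)) v N) as H.
cbv beta in H; rewrite HN in H.
replace (0 ^ 2) with 0 in H by ring; rewrite Rmult_0_r, Rminus_0_r in H.
assert (Hpos : forall j, 0 < INR (S j)) by (intros; apply lt_0_INR; lia).
eapply Rle_trans; [|eapply Rle_trans; [apply H; trivial|]].
- apply Req_le, sum_eq; intros j _; f_equal.
  rewrite <- !sqrt_div by (try apply pos_INR; apply Hpos).
  replace (1 - 1 / INR (S j)) with (INR j / INR (S j))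
    by (rewrite !S_INR; pose proof (pos_INR j); field; lra).
  replace (1 + 1 / INR (S j)) with (INR (S (S j)) / INR (S j))
    by (rewrite !S_INR; pose proof (pos_INR j); field; lra).
  ring.
- intros; lra.
- apply sqrt_pos.
- intros; apply sqrt_lt_R0, Hpos.
- apply Req_le, sum_eq; intros; ring.
Qed.

(** * Two Hardy steps for the Laplacian *)

(** [hardy_sqrt] acts on the increments of [u], then [weighted_hardy] on each power of the expanded
    weight. Truncating the expansion at [K] keeps all sums finite. *)
Lemma double_hardy (u : nat -> R) (K N : nat) :
  u 0%nat = 0 -> u 1%nat = 0 -> u (S N) = 0 -> u (S (S N)) = 0 ->
  sum_f_R0 (fun j =>
    sum_f_R0 (fun i => 2 * hardy_coef (S i) * rellich_weight (S i) (2 + j)) K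
    * u (2 + j)%nat ^ 2) N
  <= sum_f_R0 (fun j => Rabs (laplacian u (1 + j)) ^ 2) N.
Proof.
intros H0 H1 HN HN'.
pose proof (hardy_sqrt (fun j => u (S j) - u j) N) as H.
cbv beta in H; rewrite H0, H1, HN, HN', Rminus_0_r in H.
specialize (H eq_refl eq_refl).
replace (sum_f_R0 (fun j => Rabs (laplacian u (1 + j)) ^ 2) N)
  with (sum_f_R0 (fun j => (u (S (S j)) - u (S j) - (u (S j) - u j)) ^ 2) N).
2: { apply sum_eq; intros j _; rewrite pow2_abs; unfold laplacian.
  replace (1 + j + 1)%nat with (S (S j)) by lia.
  replace (1 + j - 1)%nat with j by lia.
  change (1 + j)%nat with (S j); ring. }
eapply Rle_trans; [|exact H].
apply Rle_trans with (sum_f_R0 (fun j =>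
  sum_f_R0 (fun i => 2 * hardy_coef (S i) * (1 / INR (S j)) ^ (2 * S i)) K
  * (u (S (S j)) - u (S j)) ^ 2) N).
(* Each step adds one instance of [weighted_hardy], multiplied by a nonnegative coefficient. *)
- clear H; induction K as [|K IH].
  + cbn [sum_f_R0].
    pose proof (weighted_hardy u 1 N H1 HN') as W.
    apply (Rmult_le_compat_l (2 * hardy_coef 1)) in W;
      [|pose proof (hardy_coef_ge_0 0); lra].
    rewrite !scal_sum in W.
    erewrite sum_eq; [eapply Rle_trans; [exact W|]|];
      [apply Req_le, sum_eq|]; intros; cbv beta; ring.
  + pose proof (weighted_hardy u (S (S K)) N H1 HN') as W.
    apply (Rmult_le_compat_l (2 * hardy_coef (S (S K)))) in W;
      [|pose proof (hardy_coef_ge_0 (S K)); lra].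
    rewrite !scal_sum in W.
    pose proof (Rplus_le_compat _ _ _ _ IH W) as W'.
    rewrite <- !sum_plus in W'.
    erewrite sum_eq; [eapply Rle_trans; [exact W'|]|];
      [apply Req_le, sum_eq|]; intros; rewrite tech5; ring.
- apply sum_Rle; intros j _.
  apply Rmult_le_compat_r; [apply pow2_ge_0|].
  (* At [j = 0] the argument is 1, the endpoint included in [hardy_sum]. *)
  apply hardy_sum.
  assert (Hj : 1 <= INR (S j)) by (apply (le_INR 1); lia).
  split; [apply Rdiv_lt_0_compat; lra|].
  apply Rle_div_l; lra.
Qed.

(** * From the truncated weights to [rho] *)

(** Here [2 * hardy_coef 1 = 1 / 4], so the exact term [k = 1] is the closed-form part of [rho]. *)
Lemma rellich_weight_1 (n : nat) :
  (2 <= n)%nat ->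
  2 * hardy_coef 1 * rellich_weight 1 n
  = 1 / (4 * INR n ^ 2)
    * (1 + Rpower (1 - 1 / INR n) (-2)
         - Rpower (1 - 1 / INR n) (- (1 / 2))
         - Rpower (1 + 1 / INR n) (3 / 2)).
Proof.
intros Hn; assert (Hn2 : 2 <= INR n) by (apply (le_INR 2); lia).
assert (Hx : 0 < 1 - 1 / INR n).
{ assert (1 / INR n < 1) by (apply Rlt_div_l; lra); lra. }
unfold rellich_weight; change (2 * 1)%nat with 2%nat; rewrite INR_1.
replace (1 + 1 / 2) with (3 / 2) by field.
replace (2 * hardy_coef 1) with (1 / 4)
  by (unfold hardy_coef, Binomial.C; simpl; field).
assert (E : / (1 - 1 / INR n) ^ 2 = Rpower (1 - 1 / INR n) (-2)).
{ rewrite <- Rpower_pow, <- Rpower_Ropp by lra; f_equal; simpl; ring. }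
assert (E' : Rpower (1 - 1 / INR n) (-2) * Rpower (1 - 1 / INR n) (3 / 2)
             = Rpower (1 - 1 / INR n) (- (1 / 2))).
{ rewrite <- Rpower_plus; f_equal; field. }
rewrite E, Rmult_minus_distr_l, E'.
field; lra.
Qed.

(** This is [rellich_weight_ge] at [x = 1 / n]; the identity
    [2 * (k + 1/2) ^ 2 = (2 * k + 1) ^ 2 / 2] explains the exponent [4 * k + 1] in [rho_term]. *)
Lemma rho_term_le (k n : nat) :
  (2 <= n)%nat ->
  rho_term n (S k) <= 2 * hardy_coef (S k) * rellich_weight (S k) n.
Proof.
intros Hn; assert (Hn2 : 2 <= INR n) by (apply (le_INR 2); lia).
assert (Hx : 0 < 1 / INR n < 1).
{ split; [apply Rdiv_lt_0_compat; lra|apply Rlt_div_l; lra]. }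
pose proof (rellich_weight_ge (S k) (1 / INR n) ltac:(lia) Hx) as W.
apply (Rmult_le_compat_l (2 * hardy_coef (S k) * (1 / INR n) ^ (2 * S k))) in W.
- unfold rellich_weight; rewrite <- Rmult_assoc.
  eapply Rle_trans; [apply Req_le|exact W].
  unfold rho_term, hardy_coef; rewrite !pow_add, pow_1.
  unfold Rdiv; rewrite !Rmult_1_l, !pow_inv.
  assert (2 ^ (4 * S k) <> 0) by (apply pow_nonzero; lra).
  assert (INR n ^ (2 * S k) <> 0) by (apply pow_nonzero; lra).
  rewrite S_INR; pose proof (pos_INR k); field; repeat split; lra.
- pose proof (hardy_coef_ge_0 k).
  apply Rmult_le_pos; [lra|apply pow_le; lra].
Qed.

Lemma is_lim_seq_rho (n : nat) :
  (2 <= n)%nat ->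
  is_lim_seq (fun K => 2 * hardy_coef 1 * rellich_weight 1 n
                       + sum_f_R0 (fun i => rho_term n (2 + i)) K) (rho n).
Proof.
intros Hn; rewrite rellich_weight_1 by exact Hn.
unfold rho; apply is_lim_seq_plus'; [apply is_lim_seq_const|].
pose proof (Series_correct _ (ex_series_rho n Hn)) as H.
apply is_series_Reals in H.
apply is_lim_seq_Reals; exact H.
Qed.

Lemma is_lim_seq_sum_f_R0 (f : nat -> nat -> R) (l : nat -> R) (N : nat) :
  (forall j, is_lim_seq (fun K => f K j) (l j)) ->
  is_lim_seq (fun K => sum_f_R0 (f K) N) (sum_f_R0 l N).
Proof.
intros H; induction N as [|N IH]; cbn [sum_f_R0]; [apply H|].
now apply is_lim_seq_plus'.
Qed.

Lemma Series_eq_sum_f_R0 (f : nat -> R) (N : nat) :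
  (forall n, (N < n)%nat -> f n = 0) -> Series f = sum_f_R0 f N.
Proof.
intros Hf; apply is_series_unique, is_series_Reals, is_lim_seq_Reals.
apply (is_lim_seq_incr_n _ N).
apply is_lim_seq_ext with (fun _ => sum_f_R0 f N); [|apply is_lim_seq_const].
intros n; induction n as [|n IH]; [reflexivity|].
simpl; rewrite <- IH, Hf by lia; ring.
Qed.

(** Finite support makes both outer sums finite, so [K] can tend to infinity term by term in
    [double_hardy]. *)
Lemma rellich_inequality (u : nat -> R) :
  finitely_supported u -> u 0%nat = 0 -> u 1%nat = 0 ->
  sum_from 1 (fun n : nat => Rabs (laplacian u n) ^ 2)
    >= sum_from 2 (fun n : nat => rho n * u n ^ 2).
Proof.
intros [N HN] H0 H1; unfold sum_from.
rewrite (Series_eq_sum_f_R0 (fun j => Rabs (laplacian u (1 + j)) ^ 2) N).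
2: { intros j Hj; unfold laplacian; rewrite !HN, pow2_abs by lia; ring. }
rewrite (Series_eq_sum_f_R0 (fun j => rho (2 + j) * u (2 + j)%nat ^ 2) N).
2: { intros j Hj; rewrite (HN (2 + j)%nat) by lia; ring. }
apply Rle_ge.
apply (is_lim_seq_le
  (fun K => sum_f_R0 (fun j =>
     (2 * hardy_coef 1 * rellich_weight 1 (2 + j)
      + sum_f_R0 (fun i => rho_term (2 + j) (2 + i)) K) * u (2 + j)%nat ^ 2) N)
  (fun _ => sum_f_R0 (fun j => Rabs (laplacian u (1 + j)) ^ 2) N)
  (sum_f_R0 (fun j => rho (2 + j) * u (2 + j)%nat ^ 2) N)
  (sum_f_R0 (fun j => Rabs (laplacian u (1 + j)) ^ 2) N)).
- intros K.
  eapply Rle_trans; [|apply (double_hardy u (S K) N); trivial; apply HN; lia].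
  apply sum_Rle; intros j _.
  apply Rmult_le_compat_r; [apply pow2_ge_0|].
  (* Splits off the exact term [k = 1]; the others, with [k = 2 + i], are bounded below by
     [rho_term]. *)
  rewrite (decomp_sum _ (S K)) by lia; cbn [pred].
  apply Rplus_le_compat_l, sum_Rle; intros i _.
  apply rho_term_le; lia.
- apply (is_lim_seq_sum_f_R0 (fun K j =>
    (2 * hardy_coef 1 * rellich_weight 1 (2 + j)
     + sum_f_R0 (fun i => rho_term (2 + j) (2 + i)) K) * u (2 + j)%nat ^ 2)
    (fun j => rho (2 + j) * u (2 + j)%nat ^ 2)).
  intros j; apply is_lim_seq_mult'; [|apply is_lim_seq_const].
  apply is_lim_seq_rho; lia.
- apply is_lim_seq_const.
Qed.

(** * Expansion of [rho] in powers of [1 / n] *)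

(* Coefficient of [x ^ (2 * k)] contributed by the infinite sum in [rho]: its
   term of index [k - 1], present when [k - 1 >= 2]. *)
Definition rho_even_coef (k : nat) : R :=
  match k with
  | S (S (S j)) =>
      (2 * INR (2 + j) + 1) ^ 2 * Binomial.C (4 * (2 + j)) (2 * (2 + j))
      / ((4 * INR (2 + j) - 1) * 2 ^ (4 * (2 + j) + 1))
  | _ => 0
  end.

(** With [x = 1 / n] the bracket has prefactor [x ^ 2 / 4], hence the shift by two. The conditional
    on [j] is 1 only at [j = 0]: the series of the constant 1. *)
Definition rho_coef (m : nat) : R :=
  1 / 4 * PS_incr_n (fun j => (if j then 1 else 0) + (-1) ^ j * gbinom (-2) j
             - (-1) ^ j * gbinom (- (1 / 2)) j - gbinom (3 / 2) j) 2 m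
  + (if Nat.even m then rho_even_coef (Nat.div2 m) else 0).

Lemma is_pseries_gbinom_opp (al x : R) :
  (forall m : nat, al <> INR m) -> Rabs x < 1 ->
  is_pseries (fun j => (-1) ^ j * gbinom al j) x (Rpower (1 - x) al).
Proof.
intros Hal Hx.
assert (H : is_pseries (gbinom al) (- x) (Rpower (1 + - x) al)).
{ apply is_pseries_gbinom; [exact Hal|rewrite Rabs_Ropp; exact Hx]. }
apply is_pseries_R; apply is_pseries_R in H.
eapply is_series_ext; [|exact H].
intros j; cbv beta; replace (- x) with (-1 * x) by ring.
rewrite Rpow_mult_distr; simpl; ring.
Qed.

Lemma is_pseries_bracket (x : R) :
  Rabs x < 1 ->
  is_pseries (fun j => (if j then 1 else 0) + (-1) ^ j * gbinom (-2) j
      - (-1) ^ j * gbinom (- (1 / 2)) j - gbinom (3 / 2) j) x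
    (1 + Rpower (1 - x) (-2) - Rpower (1 - x) (- (1 / 2)) - Rpower (1 + x) (3 / 2)).
Proof.
intros Hx.
apply (is_pseries_minus (V := R_NormedModule)
  (fun j => (if j then 1 else 0) + (-1) ^ j * gbinom (-2) j
      - (-1) ^ j * gbinom (- (1 / 2)) j) (gbinom (3 / 2))).
2: { apply is_pseries_gbinom; [|exact Hx].
  intros [|[|m]]; simpl INR; [lra|lra|].
  pose proof (pos_INR m); destruct m; [simpl; lra|].
  rewrite S_INR; pose proof (pos_INR m); lra. }
apply (is_pseries_minus (V := R_NormedModule)
  (fun j => (if j then 1 else 0) + (-1) ^ j * gbinom (-2) j)
  (fun j => (-1) ^ j * gbinom (- (1 / 2)) j)).
2: { apply is_pseries_gbinom_opp; [|exact Hx].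
  intros m; pose proof (pos_INR m); lra. }
apply (is_pseries_plus (V := R_NormedModule)
  (fun j : nat => if j then 1 else 0) (fun j => (-1) ^ j * gbinom (-2) j)).
2: { apply is_pseries_gbinom_opp; [|exact Hx].
  intros m; pose proof (pos_INR m); lra. }
apply is_pseries_R.
apply is_series_Reals, is_lim_seq_Reals.
apply (is_lim_seq_ext (fun _ => 1)); [|apply is_lim_seq_const].
intros n; induction n as [|n IH]; [simpl; ring|].
rewrite tech5, <- IH; ring.
Qed.

Lemma is_pseries_rho (n : nat) :
  (2 <= n)%nat -> is_pseries rho_coef (1 / INR n) (rho n).
Proof.
intros Hn; assert (Hn2 : 2 <= INR n) by (apply (le_INR 2); lia).
assert (Hx : 0 < 1 / INR n < 1).
{ split; [apply Rdiv_lt_0_compat; lra|apply Rlt_div_l; lra]. }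
assert (Hx' : Rabs (1 / INR n) < 1) by (apply Rabs_lt_between; lra).
unfold rho; apply (is_pseries_plus (V := R_NormedModule)
  (fun m => 1 / 4 * PS_incr_n _ 2 m)
  (fun m => if Nat.even m then rho_even_coef (Nat.div2 m) else 0)).
- pose proof (is_pseries_incr_n _ 2 _ _ (is_pseries_bracket _ Hx')) as H.
  pose proof (is_pseries_scal (V := R_NormedModule) (1 / 4) _ _ _
                (Rmult_comm _ _) H) as H'.
  match goal with |- is_pseries _ _ ?l =>
    match type of H' with is_pseries _ _ ?l' => replace l with l' end end.
  + exact H'.
  + unfold scal; simpl; unfold mult; simpl; unfold mult, one; simpl.
    field; lra.
- replace (sum_from 2 (rho_term n))
    with (sum_from 2 (rho_term n) + 1 / INR n * 0) by ring.
  apply is_pseries_odd_even.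
  + apply (is_pseries_ext rho_even_coef).
    { intros k; rewrite Nat.even_even, Nat.div2_double; reflexivity. }
    apply is_pseries_R.
    (* The first three coefficients are zero; entry [3 + j] is the term [k = 2 + j], as
       [x ^ (2 * k + 2) = (x ^ 2) ^ (k + 1)]. *)
    apply (is_series_decr_n _ 3); [lia|].
    replace (plus _ _) with (sum_from 2 (rho_term n)).
    2: { rewrite sum_n_Reals; unfold plus, opp; simpl; ring. }
    eapply is_series_ext; [|apply Series_correct, (ex_series_rho n Hn)].
    intros j; cbv beta; unfold rho_term.
    change (3 + j)%nat with (S (S (S j))); cbn [rho_even_coef].
    f_equal; rewrite <- pow_mult.
    unfold Rdiv; rewrite !Rmult_1_l, pow_inv; do 2 f_equal; lia.
  + apply (is_pseries_ext (fun _ => 0)).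
    { intros k; rewrite Nat.even_odd; reflexivity. }
    apply is_pseries_R, is_series_Reals, is_lim_seq_Reals.
    apply (is_lim_seq_ext (fun _ => 0)); [|apply is_lim_seq_const].
    intros k; induction k as [|k IH]; [simpl; ring|].
    rewrite tech5, <- IH; ring.
Qed.

Theorem mainTheorem6 :
  (forall u : nat -> R,
     finitely_supported u -> u 0%nat = 0 -> u 1%nat = 0 ->
     sum_from 1 (fun n : nat => Rabs (laplacian u n) ^ 2)
       >= sum_from 2 (fun n : nat => rho n * u n ^ 2))
  /\
  (exists a : nat -> R,
     (forall n : nat, (2 <= n)%nat -> is_pseries a (1 / INR n) (rho n)) /\
     (forall k : nat, (k < 4)%nat -> a k = 0) /\
     a 4%nat = 9 / 16 /\ a 5%nat = 15 / 16 /\ a 6%nat = 213 / 128).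
Proof.
split; [exact rellich_inequality|].
exists rho_coef; split; [exact is_pseries_rho|].
unfold rho_coef; repeat split.
- intros [|[|[|[|k]]]] Hk; [..|lia]; simpl; unfold zero; simpl; field.
- simpl; field.
- simpl; field.
(* Of the listed coefficients only that of [x ^ 6] involves the infinite sum, through its term
   [k = 2]. *)
- assert (HC : Binomial.C (2 * 4) 4 = 70).
  { rewrite !central_binomial_S; unfold Binomial.C; simpl; field. }
  simpl Nat.div2; unfold rho_even_coef.
  change (4 * (2 + 0))%nat with (2 * 4)%nat; change (2 * (2 + 0))%nat with 4%nat.
  rewrite HC; simpl; field.
Qed.
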